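(* In each computable lattice $L$, the set of compact elements of $L$ is $\Pi^1_1$.
   Context: A computable lattice $(L,\preceq)$ has underlying set $L=\omega$ and a computable lattice ordering $\preceq$, formally a computable subset of $\omega^2$. An element $a\in L$ is compact if for each subset $S\subseteq L$, if $a\preceq\sup S$ then there is a finite subset $S'\subseteq S$ such that $a\preceq\sup S'$; here, when $L$ is not assumed complete, ''$a\preceq\sup S$'' is read as ''$\sup S$ exists and $a\preceq\sup S$''. A set $C\subseteq\omega$ is $\Pi^1_1$ if it has the form $\{n\in\omega\mid \forall f\in\omega^\omega\ \varphi_e^f(n)\downarrow\}$ for some $e$. *)

(* Defs.v *)
From HB Require Import structures.
From mathcomp Require Import all_boot all_order.
From mathcomp Require Import classical_sets cardinality.
From Stdlib Require Cantor.

Set Implicit Arguments.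
Unset Strict Implicit.
Unset Printing Implicit Defensive.

Import Order.TTheory.

Local Open Scope classical_set_scope.
Local Open Scope nat_scope.

(* Oracle programs for partial functions from nat to nat.  Several arguments
   are passed as one number through the Cantor pairing.  The programs
   themselves serve as the indices e in the notation phi_e^f. *)
Inductive code : Type :=
  | Zero | Succ | Fst | Snd | Oracle
  | Pair of code & code
  | Comp of code & code
  | Rec of code & code
  | Mu of code.

Definition cpair (x y : nat) : nat := Cantor.to_nat (x, y).
Definition cfst (n : nat) : nat := (Cantor.of_nat n).1.
Definition csnd (n : nat) : nat := (Cantor.of_nat n).2.

(* [eval f e n m] : phi_e^f(n) converges with value m.
   - [Comp a b] is a after b;
   - [Rec a b] on <x, k> iterates: R 0 = a(x), R (i+1) = b(<x, <i, R i>>);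
   - [Mu a] on n searches for the least m with a(<n, m>) = 0, and diverges if
     a diverges at some <n, k> before such an m is reached. *)
Fixpoint eval (f : nat -> nat) (e : code) (n m : nat) : Prop :=
  match e with
  | Zero => m = 0
  | Succ => m = n.+1
  | Fst => m = cfst n
  | Snd => m = csnd n
  | Oracle => m = f n
  | Pair a b => exists y z, [/\ eval f a n y, eval f b n z & m = cpair y z]
  | Comp a b => exists2 y, eval f b n y & eval f a y m
  | Rec a b =>
      let x := cfst n in
      (fix rec (k r : nat) : Prop :=
         if k is i.+1 then
           exists2 y, rec i y & eval f b (cpair x (cpair i y)) r
         else eval f a x r) (csnd n) m
  | Mu a =>
      eval f a (cpair n m) 0 /\
      (forall k, k < m -> exists y, eval f a (cpair n k) y.+1)
  end.

Definition halts (f : nat -> nat) (e : code) (n : nat) : Prop :=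
  exists m, eval f e n m.

Definition Pi11 (C : set nat) : Prop :=
  exists e : code, C = [set n | forall f : nat -> nat, halts f e n].

(* The characteristic function of r (coerced from bool to nat) is computed by
   some program; plain computability is computability with the zero oracle. *)
Definition computable_rel (r : rel nat) : Prop :=
  exists e : code, forall x y : nat, eval (fun=> 0) e (cpair x y) (r x y).

(* "sup S exists and a <= sup S". *)
Definition le_sup (d : Order.disp_t) (L : latticeType d) (a : L) (S : set L) :
    Prop :=
  exists2 s, supremums S s & (a <= s)%O.

Definition compact_elements (d : Order.disp_t) (L : latticeType d) : set L :=
  [set a | forall S : set L, le_sup a S ->
     exists S' : set L, [/\ finite_set S', S' `<=` S & le_sup a S']].

Arguments compact_elements [d] L _.

(* [Order.Lattice d nat] is the type of lattice structures carried by nat; they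
   are unrelated to the usual order of nat.  Only the order relation is required
   to be computable, not the meet and join operations. *)
Structure computableLattice (d : Order.disp_t) := ComputableLattice {
  cl_class : Order.Lattice d nat;
  cl_lattice :> latticeType d := Order.Lattice.Pack cl_class;
  cl_computable : computable_rel (fun x y : cl_lattice => (x <= y)%O)
}.

(* Main.v *)
Require Import Defs.
From HB Require Import structures.
From mathcomp Require Import all_boot all_order.
From mathcomp Require Import classical_sets cardinality.
From mathcomp Require Import boolp.
From Stdlib Require Cantor.

(** In a countable lattice, non-compactness of [a] is always witnessed by an
    increasing sequence: a set [S] refuting compactness is nonempty, and the
    joins of longer and longer finite initial parts of an enumeration of [S]
    form a chain with the same supremum [s] as [S], all of whose terms fail to
    be above [a] ([noncompact_chain]).

    For a sequence [g] bounded by [s], being the supremum says that every [u]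
    not above [s] fails to bound some term of [g].  Since [g] is increasing,
    that property persists along [g]; after passing to a subsequence one may
    therefore ask that the term of index [u] is already such a term.  This
    absorbs the Skolem function for the quantifier over terms, so that
    [refuting_chain] is a condition of the form: for every [n], a decidable
    property of finitely many values of [g], [s] and [a] holds at [n].

    Coding [s] and [g] into one function [f], with [s = f 0] and
    [g n = f n.+1], the element [a] is compact exactly when for every [f] some
    [n] violates the condition.  A search for such an [n] with oracle [f] is
    the program that shows the set of compact elements to be [Pi11]. *)

Set Implicit Arguments.
Unset Strict Implicit.
Unset Printing Implicit Defensive.

Import Order.TTheory.

Local Open Scope classical_set_scope.
Local Open Scope nat_scope.

(** * Non-compactness through chains *)

Section Chains.
Context {d : Order.disp_t} {L : latticeType d}.
Implicit Types (a s x u : L) (S : set L) (g h : nat -> L).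
Local Open Scope order_scope.

Lemma nondecreasing_seq g : (forall n, g n <= g n.+1) ->
  forall m n, (m <= n)%N -> g m <= g n.
Proof.
move=> gS m n; elim: n => [|n IHn]; first by rewrite leqn0 => /eqP ->.
rewrite leq_eqVlt ltnS => /orP[/eqP -> //|/IHn gmn].
exact: le_trans gmn (gS n).
Qed.

Fixpoint partial_join h n : L :=
  if n is m.+1 then partial_join h m `|` h n else h 0%N.

Lemma partial_joinS h n : partial_join h n <= partial_join h n.+1.
Proof. exact: leUl. Qed.

Lemma le_partial_join h m n : (m <= n)%N -> h m <= partial_join h n.
Proof.
move=> mn; apply: (le_trans _ (nondecreasing_seq (partial_joinS h) mn)).
by case: m {mn} => [//|m]; exact: leUr.
Qed.

Lemma partial_join_le h n x :
  (forall i, (i <= n)%N -> h i <= x) -> partial_join h n <= x.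
Proof.
elim: n => [|n IHn] hx /=; first exact: hx.
rewrite leUx hx // andbT; apply: IHn => i /leqW; exact: hx.
Qed.

Lemma supremums_partial_join h n :
  supremums [set h i | i in [set i | (i < n.+1)%N]] (partial_join h n).
Proof.
split=> [_ [i /= ? <-]|x ubx]; first exact: le_partial_join.
by apply: partial_join_le => i ?; apply: ubx; exists i.
Qed.

Lemma finite_chain_bound g S : (forall n, g n <= g n.+1) ->
  finite_set S -> S `<=` range g -> exists N, ubound S (g N).
Proof.
move=> gS /finite_seqP[r ->] {S}.
elim: r => [|x r IHr] Sg; first by exists 0%N => y.
have [|N ubN] := IHr; first by move=> y /= yr; apply: Sg; rewrite /= inE yr orbT.
have [|k _ gk] := Sg x; first by rewrite /= mem_head.
exists (maxn N k) => y; rewrite /= inE => /orP[/eqP ->|yr].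
  by rewrite -gk; apply: nondecreasing_seq => //; exact: leq_maxr.
by apply: (le_trans (ubN y yr)); apply: nondecreasing_seq => //; exact: leq_maxl.
Qed.

(** The third clause expresses that every upper bound of [g] is above [s],
    with the term of [g] that shows a given element not to be an upper bound
    located at the index of that element in the enumeration [r]. *)
Definition refuting_chain (r : nat -> L) a s g n : bool :=
  [&& g n <= g n.+1, g n <= s, (s <= r n) || ~~ (g n <= r n), a <= s
    & ~~ (a <= g n)].

(** A finite subset of a chain has a term of the chain as an upper bound, so
    no finite subset of the chain can reach [a]. *)
Lemma chain_noncompact (r : nat -> L) a s g : (forall x, exists n, r n = x) ->
  (forall n, refuting_chain r a s g n) -> ~ compact_elements L a.
Proof.
move=> r_surj gP cpt_a.
have gS n : g n <= g n.+1 by have /and5P[] := gP n.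
have [|S' [finS' S'g [j [_ lub_j] aj]]] := cpt_a (range g).
  exists s; last by have /and5P[] := gP 0%N.
  split=> [_ [n _ <-]|u ubu]; first by have /and5P[] := gP n.
  have [n rn] := r_surj u; have /and5P[_ _ + _ _] := gP n.
  by rewrite rn (ubu (g n)) ?orbF//; exists n.
have [N ubN] := finite_chain_bound gS finS' S'g.
have /and5P[_ _ _ _ /negP] := gP N; apply.
exact: le_trans aj (lub_j _ ubN).
Qed.

(** The chain consists of joins of initial parts of an enumeration of a set
    [S] that refutes compactness, sped up so that the third clause of
    [refuting_chain] holds. *)
Lemma noncompact_chain (r : nat -> L) a : (forall x, exists n, r n = x) ->
  ~ compact_elements L a ->
  exists s g, forall n, refuting_chain r a s g n.
Proof.
move=> r_surj /existsNP[S /not_implyP[[s [ub_s lub_s] le_as] nfin]].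
have [x0 Sx0] : S !=set0.
  apply/set0P/eqP => S0; apply: nfin; exists S; split=> //.
    by rewrite S0; exact: finite_set0.
  by exists s.
have /choice[h hP] n : exists x, S x /\ (S (r n) -> x = r n).
  by case: (pselect (S (r n))) => [Sr|nSr]; [exists (r n)|exists x0].
pose c := partial_join h.
have nac n : ~~ (a <= c n).
  apply/negP => le_ac; apply: nfin.
  exists [set h i | i in [set i | (i < n.+1)%N]]; split.
  - exact/finite_image/finite_II.
  - by move=> _ [i _ <-]; have [] := hP i.
  - by exists (c n) => //; exact: supremums_partial_join.
have cs n : c n <= s by apply: partial_join_le => i _; apply: ub_s; have [] := hP i.
have /choice[k kP] n : exists k, s <= r n \/ ~~ (c k <= r n).
  apply: contrapT => /forallNP nk; have := nk 0%N; apply; left.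
  apply: lub_s => x Sx; have [m rm] := r_surj x.
  have -> : x = h m by have [_ ->] := hP m; rewrite rm.
  have /not_orP[_ /negP] := nk m; rewrite negbK; apply: le_trans.
  exact: le_partial_join.
(* The partial sums of [k] are a nondecreasing reindexing that dominates [k]. *)
pose K n := (\sum_(i < n.+1) k i)%N.
have cmon := nondecreasing_seq (partial_joinS h).
exists s, (c \o K) => n; apply/and5P; split=> //=.
  by apply: cmon; rewrite /K [leqRHS]big_ord_recr leq_addr.
have [->//|nck] := kP n; apply/orP; right; apply: contra nck; apply: le_trans.
by apply: cmon; rewrite /K big_ord_recr leq_addl.
Qed.

End Chains.

(** * Oracle programs *)

Lemma cfst_pair x y : cfst (cpair x y) = x.
Proof. by rewrite /cfst /cpair Cantor.cancel_of_to. Qed.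

Lemma csnd_pair x y : csnd (cpair x y) = y.
Proof. by rewrite /csnd /cpair Cantor.cancel_of_to. Qed.

Lemma cpair_fst_snd n : cpair (cfst n) (csnd n) = n.
Proof. by rewrite /cpair /cfst /csnd -surjective_pairing Cantor.cancel_to_of. Qed.

Lemma eval_functional f e n m m' : eval f e n m -> eval f e n m' -> m = m'.
Proof.
elim: e n m m' => [|||||a IHa b IHb|a IHa b IHb|a IHa b IHb|a IHa] n m m' /=;
  try by move=> -> ->.
- move=> [y [z [ay bz ->]]] [y' [z' [ay' bz' ->]]].
  by rewrite (IHa _ _ _ ay ay') (IHb _ _ _ bz bz').
- move=> [y hy ym] [y' hy' ym']; rewrite (IHb _ _ _ hy hy') in ym.
  exact: IHa ym ym'.
- elim: (csnd n) m m' => [|i IHi] m m'; first exact: IHa.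
  move=> [y hy ym] [y' hy' ym']; rewrite (IHi _ _ hy hy') in ym.
  exact: IHb ym ym'.
- move=> [m0 mlt] [m0' mlt'].
  have [lt|lt|//] := ltngtP m m'.
    by have [y hy] := mlt' _ lt; have := IHa _ _ _ hy m0.
  by have [y hy] := mlt _ lt; have := IHa _ _ _ hy m0'.
Qed.

Fixpoint unoracle (e : code) : code :=
  match e with
  | Oracle => Zero
  | Pair a b => Pair (unoracle a) (unoracle b)
  | Comp a b => Comp (unoracle a) (unoracle b)
  | Rec a b => Rec (unoracle a) (unoracle b)
  | Mu a => Mu (unoracle a)
  | _ => e
  end.

(** The ordering is decided with the zero oracle, whereas the search has the
    candidate chain as its oracle.  Answering the queries of the decision
    program by the constant zero lets it run as a part of the search. *)
Lemma eval_unoracle f e n m :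
  eval (fun=> 0) e n m -> eval f (unoracle e) n m.
Proof.
elim: e n m => [|||||a IHa b IHb|a IHa b IHb|a IHa b IHb|a IHa] n m //=.
- by move=> [y [z [/IHa ? /IHb ? ->]]]; exists y, z.
- by move=> [y /IHb ? /IHa ?]; exists y.
- elim: (csnd n) m => [|i IHi] m; first exact: IHa.
  by move=> [y /IHi ? /IHb ?]; exists y.
- move=> [/IHa m0 mlt]; split=> // k /mlt[y /IHa ?]; by exists y.
Qed.

Definition Id := Pair Fst Snd.
Definition Not p := Comp (Rec (Comp Succ Zero) Zero) (Pair Zero p).
Definition And p q := Comp (Rec Zero (Comp q Fst)) (Pair Id p).

Section Programs.
Variables (f : nat -> nat) (n : nat).

Lemma eval_Id : eval f Id n n.
Proof. by exists (cfst n), (csnd n); rewrite cpair_fst_snd. Qed.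

Lemma eval_Pair a b x y :
  eval f a n x -> eval f b n y -> eval f (Pair a b) n (cpair x y).
Proof. by exists x, y. Qed.

Lemma eval_Not p (b : bool) : eval f p n b -> eval f (Not p) n (~~ b).
Proof.
move=> pb; exists (cpair 0 b); first exact: (eval_Pair (a := Zero)).
rewrite /= csnd_pair; case: b {pb} => /=; last by exists 0.
by exists 1 => //; exists 0.
Qed.

(** The recursion counter is the value of [p], so that [q] runs once or not at
    all. *)
Lemma eval_And p q (b c : bool) :
  eval f p n b -> eval f q n c -> eval f (And p q) n (b && c).
Proof.
move=> pb qc; exists (cpair n b); first exact: eval_Pair eval_Id pb.
rewrite /= csnd_pair cfst_pair; case: b {pb} => //=.
by exists 0 => //; exists n; rewrite ?cfst_pair.
Qed.

(** Since [p] has only one value on each input, the search cannot stop where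
    [P] holds; since [p] is total, nothing blocks it before the least failure
    of [P]. *)
Lemma halts_Mu p (P : pred nat) : (forall k, eval f p (cpair n k) (P k)) ->
  halts f (Mu p) n <-> exists k, ~~ P k.
Proof.
move=> pP; split=> [[m [m0 _]]|exP].
  by exists m; have := eval_functional m0 (pP m); case: (P m).
case: (ex_minnP exP) => m nPm m_min; exists m; split.
  by have := pP m; rewrite (negbTE nPm).
move=> k km; exists 0; have := pP k; case: (boolP (P k)) => // /m_min.
by rewrite leqNgt km.
Qed.

End Programs.

(** * The search program for a lattice *)

(** The program tests [refuting_chain] on input [cpair a n], for the identity
    enumeration, where [ord] decides the ordering and the oracle [f] codes
    [s = f 0] and the sequence [f n.+1]. *)
Definition chain_test (ord : code) : code :=
  let le x y := Comp ord (Pair x y) in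
  let s := Comp Oracle Zero in
  let g := Comp Oracle (Comp Succ Snd) in
  let g' := Comp Oracle (Comp Succ (Comp Succ Snd)) in
  And (le g g') (And (le g s) (And (Not (And (Not (le s Snd)) (le g Snd)))
    (And (le Fst s) (Not (le Fst g))))).

Lemma eval_chain_test (d : Order.disp_t) (L : computableLattice d) :
  exists ord, forall (f : nat -> nat) (a n : nat),
    eval f (chain_test ord) (cpair a n)
      (refuting_chain (L := L) id a (f 0) (fun i => f i.+1) n).
Proof.
have [e eP] := cl_computable L; exists (unoracle e) => f a n.
set i := cpair a n.
have evle x y (u v : nat) : eval f x i u -> eval f y i v ->
    eval f (Comp (unoracle e) (Pair x y)) i ((u : L) <= (v : L))%O.
  move=> xu yv; exists (cpair u v); first exact: eval_Pair.
  exact: eval_unoracle (eP u v).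
have evF : eval f Fst i a by rewrite /= cfst_pair.
have evN : eval f Snd i n by rewrite /= csnd_pair.
have evs : eval f (Comp Oracle Zero) i (f 0) by exists 0.
have evg : eval f (Comp Oracle (Comp Succ Snd)) i (f n.+1).
  by exists n.+1 => //; exists n.
have evg' : eval f (Comp Oracle (Comp Succ (Comp Succ Snd))) i (f n.+2).
  by exists n.+2 => //; exists n.+1 => //; exists n.
(* The disjunction is expressed through [And] and [Not]. *)
rewrite /refuting_chain -[X in [&& _, _, X, _ & _]]negbK negb_or negbK.
by do ![apply: eval_And | apply: eval_Not | apply: evle].
Qed.

Theorem lemma2p6 (d : Order.disp_t) (L : computableLattice d) :
  Pi11 (compact_elements L).
Proof.
have [ord ordP] := eval_chain_test L.
have id_surj (x : L) : exists n : nat, id n = x :> L by exists x.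
exists (Mu (chain_test ord)); apply/seteqP; split=> a /=.
  move=> cpt_a f; apply/(halts_Mu (ordP f a)).
  apply: contrapT => /forallNP noviol.
  apply: (chain_noncompact id_surj _ cpt_a) => n.
  by have /negP := noviol n; rewrite negbK; apply.
move=> halt_a; apply: contrapT => /(noncompact_chain id_surj)[s [g gP]].
have /(halts_Mu (ordP _ a))[n] := halt_a (fun i => if i is j.+1 then g j else s).
by move/negP; apply; exact: gP.
Qed.
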